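(* Let $M\in\mathbb{N}^{m\times m}$ be an upper block triangular matrix of the form $$M=\begin{pmatrix} P_1 & B_{1,2} & \cdots & B_{1,h}\\ 0 & P_2 & \ddots & \vdots\\ \vdots & \ddots & \ddots & B_{h-1,h}\\ 0 & \cdots & 0 & P_h\end{pmatrix}$$ where each diagonal square block $P_\ell$ is either primitive or the $1\times 1$ zero matrix $(0)$. For all $i,j\in\{1,\ldots,m\}$, either $(M^n)_{i,j}=0$ for all sufficiently large $n$, or there exist $\lambda\in\mathrm{Spec}(M)\cap\mathbb{R}_{\ge 1}$ and $d\in\mathbb{N}$ such that $(M^n)_{i,j}=\Theta(n^d\lambda^n)$. More precisely, in the second case, if $M_{i,j}$ is an entry of the block $B_{k,\ell}$ with $1\le k<\ell\le h$, or an entry of $P_\ell$ (in which case we set $k=\ell$), then, letting $\mathcal{C}_{k,\ell}$ denote the set of all sequences $k=m_1<m_2<\cdots<m_t=\ell$ ($t\ge 1$) such that $B_{m_1,m_2}\neq 0,\ B_{m_2,m_3}\neq 0,\ \ldots,\ B_{m_{t-1},m_t}\neq 0$, we have $$\lambda=\max_{(m_1,\ldots,m_t)\in\mathcal{C}_{k,\ell}}\ \max\{\rho(P_{m_s})\mid s\in\{1,\ldots,t\}\},$$ $$d+1=\max_{(m_1,\ldots,m_t)\in\mathcal{C}_{k,\ell}}\ \#\{s\in\{1,\ldots,t\}\mid \rho(P_{m_s})=\lambda\}.$$ In particular, the asymptotic behaviors of $(M^n)_{i,j}$ corresponding to entries of a given block $B_{k,\ell}$ coincide.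
   Context: $\mathbb{N}=\{0,1,2,\ldots\}$. A non-negative square matrix $P$ is primitive if there is a positive integer $k$ such that all entries of $P^k$ are positive. $\mathrm{Spec}(M)$ is the multiset of (complex) eigenvalues of $M$ and $\rho(M)=\max\{|\lambda|\mid\lambda\in\mathrm{Spec}(M)\}$ is its spectral radius. For non-negative sequences, $a_n=\Theta(b_n)$ means that there exist constants $c,C>0$ such that $c\,b_n\le a_n\le C\,b_n$ for all sufficiently large $n$. *)

(* Defs.v *)
From HB Require Import structures.
From mathcomp Require Export all_boot all_order all_algebra.
From mathcomp Require Export all_classical all_reals all_analysis.
From mathcomp Require Export complex.
Set Implicit Arguments.
Unset Strict Implicit.
Unset Printing Implicit Defensive.
Export Order.TTheory GRing.Theory Num.Theory numFieldNormedType.Exports.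

#[global] Open Scope classical_set_scope.
#[global] Open Scope ring_scope.
#[global] Open Scope complex_scope.

Definition primitive_mx n (P : 'M[nat]_n) : Prop :=
  exists2 k : nat, (0 < k)%N & forall i j, (0 < (P ^+ k) i j)%N.

(* The multiset of complex eigenvalues: the roots of the characteristic
   polynomial listed with multiplicity, in an unspecified order. *)
Definition spec (R : realType) n (M : 'M[nat]_n) : seq R[i] :=
  sval (closed_field_poly_normal
    (char_poly (map_mx (fun a : nat => a%:R : R[i]) M))).

(* [normc] is the complex modulus with values in [R]. For [0 < n] the spectrum
   is nonempty, so the default value [0] of the maximum is irrelevant. *)
Definition spectral_radius (R : realType) n (M : 'M[nat]_n) : R :=
  \big[Num.max/0]_(z <- spec R M) ComplexField.Normc.normc z.

Definition is_max d (T : porderType d) (A : set T) (x : T) : Prop :=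
  A x /\ ubound A x.

Section BlockMatrix.
Variables (R : realType) (h : nat) (p : 'I_h -> nat).
Variable M : 'M[nat]_(\sum_(l < h) p l).

Definition eventually_zero (i j : 'I_(\sum_(l < h) p l)) : Prop :=
  \forall n \near \oo, (M ^+ n) i j = 0.

Definition has_growth (i j : 'I_(\sum_(l < h) p l)) (lam : R) (d : nat) : Prop :=
  [/\ lam%:C \in spec R M, 1 <= lam &
      (fun n => ((M ^+ n) i j)%:R : R^o) =Theta_\oo
      (fun n => n%:R ^+ d * lam ^+ n : R^o)].

(* The set C_{k,l} of chains k = m_1 < ... < m_t = l of blocks. *)
Definition block_chains (k l : 'I_h) : set (seq 'I_h) :=
  [set s | exists s', [/\ s = k :: s', last k s' = l &
    path (fun m m' : 'I_h => (m < m')%N && (submxblock M m m' != 0)) k s']].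

Definition block_radius (m : 'I_h) : R := spectral_radius R (submxblock M m m).

Definition chain_radius (s : seq 'I_h) : R :=
  \big[Num.max/0]_(m <- s) block_radius m.

Definition chain_count (lam : R) (s : seq 'I_h) : nat :=
  count (fun m => block_radius m == lam) s.

End BlockMatrix.

(* Main.v *)
(** A primitive block [P] has a positive left eigenvector for
    [spectral_radius P]: if [v] is an eigenvector for an eigenvalue of maximal
    modulus [r], then [x = |v|] satisfies [x P >= r x], and a strict inequality
    somewhere would give a positive [y = x P^k] and some [s > r] with [y P >= s y],
    so that the entries of [P^n] could not be [O(t^n)] for [r < t < s], contrary to
    Cayley-Hamilton. Hence every entry of [P^n] is [Theta(r^n)].

    A path through the block graph leaves each block once, so the block
    [(k, l)] of [M^n] is obtained by convolving powers of [P_k] with the blocks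
    [(m, l)], [m > k], of lower powers of [M]. Fix [lam] and let the class [c]
    consist of the sequences of order [n^(c-1) lam^n], or of order [s^n] for some
    [s < lam] when [c = 0]; under convolution the classes add up. So an upper bound
    for all chains and a lower bound along one optimal chain follow by induction.
    With [lam = 1], class [0] forces a sequence of natural numbers to vanish
    eventually. *)

Require Import Defs.
From mathcomp Require Import lra ring zify.
Import ComplexField.Normc.

Set Implicit Arguments.
Unset Strict Implicit.
Unset Printing Implicit Defensive.

(** * Preliminaries on moduli and matrix powers *)

Lemma normc_ge0 (R : realType) (z : R[i]) : 0 <= normc z.
Proof. by case: z => a b; rewrite sqrtr_ge0. Qed.

Lemma eigenvector_mulX (F : comNzRingType) n (A : 'M[F]_n) (x : 'rV[F]_n) (r : F) t :
  x *m A = r *: x -> x *m A ^+ t = r ^+ t *: x.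
Proof.
move=> xA; elim: t => [|t IH]; first by rewrite !expr0 scale1r mulmx1.
by rewrite !exprSr -mulmxE mulmxA IH -scalemxAl xA scalerA.
Qed.

Lemma natr_mxX (S : nzSemiRingType) n (P : 'M[nat]_n) t i j :
  (map_mx (fun a : nat => a%:R : S) P ^+ t) i j = ((P ^+ t) i j)%:R.
Proof.
elim: t i j => [|t IH] i j; first by rewrite !expr0 !mxE; case: eqP.
rewrite !exprS !mxE natr_sum; apply: eq_bigr => l _.
by rewrite !mxE IH natrM.
Qed.

(** * Perron-Frobenius for primitive matrices *)

Section Spectrum.
Variables (R : realType) (n : nat) (P : 'M[nat]_n).
Local Notation PC := (map_mx (fun a : nat => a%:R : R[i]) P).

Lemma char_poly_spec : char_poly PC = \prod_(z <- spec R P) ('X - z%:P).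
Proof.
rewrite /spec; case: closed_field_poly_normal => r /= {1}->.
by rewrite (monicP (char_poly_monic _)) scale1r.
Qed.

Lemma mem_spec z : (z \in spec R P) = eigenvalue PC z.
Proof. by rewrite eigenvalue_root_char char_poly_spec root_prod_XsubC. Qed.

Lemma normc_le_spectral_radius z :
  z \in spec R P -> normc z <= spectral_radius R P.
Proof. by move=> zP; apply: le_bigmax_seq. Qed.

Lemma spectral_radius_attained :
  (0 < n)%N -> exists2 z, z \in spec R P & normc z = spectral_radius R P.
Proof.
move=> n0.
have : spec R P != [::].
  apply/eqP => s0; have := size_char_poly PC.
  by rewrite char_poly_spec s0 big_nil size_poly1 => -[] n00; rewrite -n00 in n0.
rewrite /spectral_radius; elim: (spec R P) => // z s IH _.
rewrite big_cons; case: (eqVneq s [::]) => [->|s0].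
  by exists z; rewrite ?inE // big_nil max_l // normc_ge0.
have [y ys <-] := IH s0; rewrite /Num.max; case: ifP => _.
  by exists y; rewrite // inE ys orbT.
by exists z; rewrite // inE eqxx.
Qed.

End Spectrum.

(* Applied to the entries of [horner_mx A], with [zs] the spectrum: the factors of
   the characteristic polynomial are peeled off one at a time. *)
Lemma linear_factors_bound (R : realType) (u : {poly R[i]} -> R[i]) (s : R)
    (zs : seq R[i]) :
  (forall q z, u (q * ('X - z%:P)) = u (q * 'X) - z * u q) -> 0 < s ->
  (forall z, z \in zs -> normc z < s) -> forall q,
  (exists C, forall n,
     normc (u (q * \prod_(z <- zs) ('X - z%:P) * 'X^n)) <= C * s ^+ n) ->
  exists C, forall n, normc (u (q * 'X^n)) <= C * s ^+ n.
Proof.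
move=> uE s0; elim: zs => [|z zs IH] zs_s q [C HC].
  by exists C => n; have := HC n; rewrite big_nil mulr1.
have zs_s' y : y \in zs -> normc y < s.
  by move=> yzs; apply: zs_s; rewrite inE yzs orbT.
have [|{HC}C HC] := IH zs_s' (q * ('X - z%:P)).
  by exists C => n; have := HC n; rewrite big_cons !mulrA.
have zs0 : 0 < s - normc z by rewrite subr_gt0 zs_s // inE eqxx.
(* The values [u (q * 'X^n)] satisfy a recursion with multiplier [z] and error at most [C * s ^+ n].
   This [K] covers [n = 0] and gives [C + normc z * K <= s * K], so the bound propagates. *)
pose K := Num.max (normc (u q)) (C / (s - normc z)).
have KC : C <= K * (s - normc z) by rewrite -ler_pdivrMr // /K le_max lexx orbT.
exists K; elim=> [|n IHn]; first by rewrite !expr0 !mulr1 le_max lexx.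
have -> : u (q * 'X^(n.+1)) = u (q * ('X - z%:P) * 'X^n) + z * u (q * 'X^n).
  by rewrite mulrAC uE exprSr mulrA subrK.
apply: le_trans (le_normcD _ _) _; rewrite normcM.
have Kn : normc z * normc (u (q * 'X^n)) <= normc z * (K * s ^+ n).
  by apply: ler_wpM2l; rewrite ?normc_ge0.
apply: le_trans (lerD (HC n) Kn) _.
have : C * s ^+ n <= K * (s - normc z) * s ^+ n.
  by apply: ler_wpM2r => //; rewrite exprn_ge0 // ltW.
by rewrite exprSr; lra.
Qed.

(** The characteristic polynomial annihilates the matrix, so [linear_factors_bound] can start from
    the constant [0]. *)
Lemma mx_power_bound (R : realType) n (P : 'M[nat]_n) (s : R) :
  spectral_radius R P < s ->
  forall i j, exists C, forall t, ((P ^+ t) i j)%:R <= C * s ^+ t.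
Proof.
case: n P => [|n] P Ps i j; first by case: i.
have s0 : 0 < s.
  apply: le_lt_trans Ps; have [z _ <-] := @spectral_radius_attained R _ P isT.
  exact: normc_ge0.
pose A := map_mx (fun a : nat => a%:R : R[i]) P.
pose u q := (horner_mx A q) i j.
have uE q z : u (q * ('X - z%:P)) = u (q * 'X) - z * u q.
  rewrite /u mulrBr rmorphB /= [q * z%:P]mulrC mul_polyC linearZ /=.
  by rewrite !mxE.
have spec_s z : z \in spec R P -> normc z < s.
  by move=> /normc_le_spectral_radius zP; apply: le_lt_trans zP Ps.
have [|C HC] := @linear_factors_bound R u s (spec R P) uE s0 spec_s 1.
  exists 0 => t; rewrite mul1r -char_poly_spec /u rmorphM /= Cayley_Hamilton.
  by rewrite mul0r mxE mul0r normc0.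
exists C => t; have := HC t; rewrite mul1r /u rmorphXn /= horner_mx_X natr_mxX.
suff -> (a : nat) : normc (a%:R : R[i]) = a%:R by [].
by rewrite normcMn normc1.
Qed.

Lemma exp_dominates (R : realType) (s t c C : R) :
  0 <= t < s -> 0 < c -> exists n, C * t ^+ n < c * s ^+ n.
Proof.
move=> /andP[t0 ts] c0; have s0 : 0 < s by apply: le_lt_trans ts.
have q1 : `|t / s| < 1 by rewrite ger0_norm ?ltr_pdivrMr ?mul1r // divr_ge0 // ltW.
have : (fun n => C * (t / s) ^+ n) @ \oo --> C * 0.
  by apply: cvgMr; apply: cvg_expr.
rewrite mulr0 => /cvgr_lt /(_ _ c0) [N _ /(_ N (leqnn N))] /= H.
exists N; rewrite -ltr_pdivrMr ?exprn_gt0 //.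
by rewrite -mulrA -expr_div_n.
Qed.

Section Perron.
Variables (R : realType) (n : nat).
Local Notation natrmx Q := (map_mx (fun a : nat => a%:R : R) Q).

Lemma natrmxX (P : 'M[nat]_n) t : natrmx (P ^+ t) = natrmx P ^+ t.
Proof. by apply/matrixP => i j; rewrite natr_mxX mxE. Qed.

Lemma row_mul_gt0 (x : 'rV[R]_n) (Q : 'M[nat]_n) :
  (forall i, 0 <= x 0 i) -> x != 0 -> (forall i j, (0 < Q i j)%N) ->
  forall j, 0 < (x *m natrmx Q) 0 j.
Proof.
move=> x0 xn0 Q0 j; rewrite mxE lt0r sumr_ge0 ?andbT; last first.
  by move=> i _; rewrite !mxE mulr_ge0.
apply: contraNneq xn0 => xQ0; apply/eqP/rowP => i; rewrite mxE.
have : \sum_i x 0 i * natrmx Q i j == 0 by rewrite xQ0.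
rewrite psumr_eq0; last by move=> l _; rewrite !mxE mulr_ge0.
move=> /allP/(_ i); rewrite mem_index_enum => /(_ isT) /=.
by rewrite mulf_eq0 !mxE pnatr_eq0 => /orP[/eqP//|/eqP Q00]; have := Q0 i j; rewrite Q00.
Qed.

Lemma supereigenvector (P : 'M[nat]_n) : (0 < n)%N ->
  exists x : 'rV[R]_n, [/\ x != 0, forall i, 0 <= x 0 i &
    forall j, spectral_radius R P * x 0 j <= (x *m natrmx P) 0 j].
Proof.
move=> n0; have [z] := spectral_radius_attained R P n0.
rewrite mem_spec => /eigenvalueP[v vP v0] <-.
exists (\row_j normc (v 0 j)); split.
- apply: contraNneq v0 => /rowP x0; apply/eqP/rowP => i.
  by have := x0 i; rewrite !mxE; apply: eq0_normc.
- by move=> i; rewrite mxE normc_ge0.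
move=> j; have /rowP/(_ j) := vP; rewrite !mxE -normcM => <-.
elim/big_ind2: _ => [|z1 x1 z2 x2 H1 H2|i _]; first by rewrite normc0.
- by apply: le_trans (le_normcD _ _) _; apply: lerD.
- by rewrite !mxE normcM normcMn normc1.
Qed.

Lemma spectral_radius_ge0 (P : 'M[nat]_n) : (0 < n)%N ->
  0 <= spectral_radius R P.
Proof.
by move=> n0; have [z _ <-] := spectral_radius_attained R P n0; apply: normc_ge0.
Qed.

(** The least of the finitely many ratios [w j / y j] serves as [s]. *)
Lemma strict_growth_rate (r : R) (y w : 'I_n -> R) : (0 < n)%N ->
  (forall j, 0 < y j) -> (forall j, r * y j < w j) ->
  exists2 s, r < s & forall j, s * y j <= w j.
Proof.
case: n y w => // n' y w _ y0 yw.
pose j0 := [arg min_(j < ord0) (w j / y j)]%O.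
exists (w j0 / y j0); first by rewrite ltr_pdivlMr.
rewrite /j0; case: arg_minP => // i _ Hi j.
by rewrite -ler_pdivlMr // Hi.
Qed.

Lemma row_mulX_ge (P : 'M[nat]_n) (s : R) (y : 'rV[R]_n) : 0 <= s ->
  (forall j, s * y 0 j <= (y *m natrmx P) 0 j) ->
  forall t j, s ^+ t * y 0 j <= (y *m natrmx P ^+ t) 0 j.
Proof.
move=> s0 yP; elim=> [|t IH] j; first by rewrite expr0 mul1r expr0 mulmx1.
rewrite exprSr (exprSr (natrmx P)) -mulmxE mulmxA [X in _ <= X]mxE.
apply: (@le_trans _ _ (\sum_i (s ^+ t * y 0 i) * natrmx P i j)).
  under eq_bigr do rewrite -mulrA; rewrite -mulr_sumr -mulrA.
  by apply: ler_wpM2l; rewrite ?exprn_ge0 //; have := yP j; rewrite mxE.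
by apply: ler_sum => i _; apply: ler_wpM2r; rewrite ?IH // mxE.
Qed.

Lemma perron_vector (P : 'M[nat]_n) : (0 < n)%N -> primitive_mx P ->
  exists x : 'rV[R]_n, (forall i, 0 < x 0 i) /\
    x *m natrmx P = spectral_radius R P *: x.
Proof.
move=> n0 [k k0 Pk]; set r := spectral_radius R P.
have [x [xn0 x0 xP]] := supereigenvector P n0.
have r0 : 0 <= r by apply: spectral_radius_ge0.
suff xE : x *m natrmx P = r *: x.
  exists x; split=> // i.
  have := row_mul_gt0 x0 xn0 Pk i.
  by rewrite natrmxX (eigenvector_mulX _ xE) mxE !lt0r x0 andbT mulf_eq0 negb_or => /andP[/andP[]].
(* The defect [x P - r x] is non-negative; if it were nonzero, multiplication by the positive
   [P ^+ k] would make it positive in every column. *)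
apply/eqP; rewrite -subr_eq0; apply/negPn/negP => dn0.
pose y := x *m natrmx (P ^+ k).
have y0 j : 0 < y 0 j by apply: row_mul_gt0.
have yP j : r * y 0 j < (y *m natrmx P) 0 j.
  have yPE : y *m natrmx P = x *m natrmx P *m natrmx (P ^+ k).
    by rewrite /y -!mulmxA natrmxX mulmxE -exprSr exprS.
  rewrite -subr_gt0.
  have -> : (y *m natrmx P) 0 j - r * y 0 j =
      ((x *m natrmx P - r *: x) *m natrmx (P ^+ k)) 0 j.
    by rewrite yPE mulmxBl -scalemxAl [RHS]mxE [X in _ = _ + X]mxE [X in _ = _ - X]mxE.
  by apply: row_mul_gt0 => // i; have := xP i; rewrite !mxE subr_ge0.
have [s rs ys] := strict_growth_rate n0 y0 yP.
(* With [r < t < s], the entries of [P ^+ m] are at most of order [t ^+ m], while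
   [y P ^+ m >= s ^+ m y]. *)
pose t := (r + s) / 2; have rt : r < t by rewrite /t; lra.
have t0 : 0 <= t by lra.
have ts : 0 <= t < s by rewrite t0 /t; lra.
pose j0 := Ordinal n0.
have /choice [C HC] : forall i, exists c, forall m, ((P ^+ m) i j0)%:R <= c * t ^+ m.
  by move=> i; apply: mx_power_bound.
have [m] := exp_dominates (\sum_i y 0 i * C i) ts (y0 j0).
apply/negP; rewrite -leNgt mulrC.
have s0 : 0 <= s by lra.
apply: le_trans (row_mulX_ge s0 ys m j0) _.
rewrite mxE mulr_suml; apply: ler_sum => i _; rewrite -mulrA.
rewrite natr_mxX; apply: ler_wpM2l; [exact: ltW|exact: HC].
Qed.

(** For positive [x], this weighted column sum controls single entries of [P ^+ t] from both
    sides. *)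
Lemma perron_vectorX (P : 'M[nat]_n) (x : 'rV[R]_n) (r : R) :
  x *m natrmx P = r *: x ->
  forall t j, \sum_i x 0 i * ((P ^+ t) i j)%:R = r ^+ t * x 0 j.
Proof.
move=> xP t j.
have <- : (x *m natrmx (P ^+ t)) 0 j = \sum_i x 0 i * ((P ^+ t) i j)%:R.
  by rewrite mxE; apply: eq_bigr => i _; rewrite mxE.
by rewrite natrmxX (eigenvector_mulX _ xP) mxE.
Qed.

(** The entries of [P ^+ k] are positive integers, so the diagonal term alone gives
    [r ^+ k * x 0 j >= x 0 j]. *)
Lemma spectral_radius_ge1 (P : 'M[nat]_n) : (0 < n)%N -> primitive_mx P ->
  1 <= spectral_radius R P.
Proof.
move=> n0 primP; have [x [x0 xP]] := perron_vector n0 primP.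
have [k k0 Pk] := primP; have := perron_vectorX xP k (Ordinal n0).
set r := spectral_radius R P => rk.
have r0 : 0 <= r by apply: spectral_radius_ge0.
rewrite -(@expr_ge1 _ k) ?k0 // -(ler_pM2r (x0 (Ordinal n0))) mul1r -rk.
rewrite (bigD1 (Ordinal n0)) //= -[X in X <= _]addr0; apply: lerD.
  by apply: ler_peMr; [exact: ltW|rewrite ler1n; apply: Pk].
by apply: sumr_ge0 => i _; rewrite mulr_ge0 // ltW.
Qed.

Lemma primitive_upper (P : 'M[nat]_n) : (0 < n)%N -> primitive_mx P ->
  forall i j, exists C, forall t, ((P ^+ t) i j)%:R <= C * spectral_radius R P ^+ t.
Proof.
move=> n0 primP i j; have [x [x0 xP]] := perron_vector n0 primP.
exists (x 0 j / x 0 i) => t; rewrite mulrAC ler_pdivlMr // mulrC.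
rewrite [X in _ <= X]mulrC -(perron_vectorX xP) (bigD1 i) //= ler_wpDr //.
by apply: sumr_ge0 => l _; rewrite mulr_ge0 // ltW.
Qed.

(** Split [P ^+ t] as [P ^+ k] times [P ^+ m]. Row [i] of [P ^+ k] has entries at least [1], so the
    entry dominates a column sum of [P ^+ m], which is at least [r ^+ m * x 0 j / X]. *)
Lemma primitive_lower (P : 'M[nat]_n) : (0 < n)%N -> primitive_mx P ->
  forall i j, exists c N, 0 < c /\
    forall t, (N <= t)%N -> c * spectral_radius R P ^+ t <= ((P ^+ t) i j)%:R.
Proof.
move=> n0 primP i j; have [x [x0 xP]] := perron_vector n0 primP.
have r0 : 0 < spectral_radius R P.
  by apply: lt_le_trans (spectral_radius_ge1 n0 primP).
have [k k0 Pk] := primP; set r := spectral_radius R P in r0 xP *.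
pose X := \sum_l x 0 l.
have xX l : x 0 l <= X.
  by rewrite /X (bigD1 l) //= lerDl sumr_ge0 // => m _; rewrite ltW.
have X0 : 0 < X by apply: lt_le_trans (xX j).
exists (x 0 j / (X * r ^+ k)), k; split.
  by rewrite divr_gt0 // mulr_gt0 // exprn_gt0.
move=> t /subnKC <-; set m := (t - k)%N.
rewrite !exprD invfM -!mulrA [(r ^+ k)^-1 * _]mulrA mulVf ?gt_eqF ?exprn_gt0 // mul1r.
rewrite mulrCA ler_pdivrMl // [x 0 j * _]mulrC -(perron_vectorX xP m j).
rewrite -mulmxE mxE natr_sum mulr_sumr; apply: ler_sum => l _.
rewrite natrM mulrA; apply: ler_wpM2r => //.
apply: le_trans (xX l) _; apply: ler_peMr; first exact: ltW.
by rewrite ler1n; apply: Pk.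
Qed.

Lemma perron_root (P : 'M[nat]_n) : (0 < n)%N -> primitive_mx P ->
  (spectral_radius R P)%:C \in spec R P.
Proof.
move=> n0 primP; have [x [x0 xP]] := perron_vector n0 primP.
rewrite mem_spec; apply/eigenvalueP; exists (map_mx (real_complex R) x).
  have -> : map_mx (fun a : nat => a%:R : R[i]) P =
            map_mx (real_complex R) (natrmx P).
    by apply/matrixP => i j; rewrite !mxE rmorph_nat.
  by rewrite -map_mxM xP map_mxZ.
apply/negP => /eqP/rowP/(_ (Ordinal n0)); rewrite !mxE => /eqP.
by rewrite fmorph_eq0 gt_eqF.
Qed.

Lemma spectral_radius0 : (0 < n)%N -> spectral_radius R (0 : 'M[nat]_n) = 0.
Proof.
move=> n0; have [z] := spectral_radius_attained R (0 : 'M[nat]_n) n0.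
rewrite mem_spec => /eigenvalueP[v vP v0] <-.
have : z *: v = 0.
  rewrite -vP; apply/rowP => j; rewrite !mxE big1 // => i _.
  by rewrite !mxE mulr0.
by move=> /eqP; rewrite scaler_eq0 (negPf v0) orbF => /eqP ->; rewrite normc0.
Qed.

End Perron.

(** * Growth classes and convolution *)

(* Class [d.+1] means order [n^d lam^n]; class [0] is of order [s^n] for some
   [s < lam] in [rate_le], and just not identically zero in [rate_ge]. *)
Definition rate_le (R : realType) (lam : R) (c : nat) (f : nat -> nat) : Prop :=
  if c is d.+1 then exists C, forall n, (f n)%:R <= C * (n.+1%:R ^+ d * lam ^+ n)
  else exists s C, 0 <= s < lam /\ forall n, (f n)%:R <= C * s ^+ n.

Definition rate_ge (R : realType) (lam : R) (c : nat) (f : nat -> nat) : Prop :=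
  if c is d.+1 then exists C N, 0 < C /\
    forall n, (N <= n)%N -> C * (n%:R ^+ d * lam ^+ n) <= (f n)%:R
  else exists n, (0 < f n)%N.

(* Indexed so that [conv f g n] collects [f t * g u] with [t + u + 1 = n]: one step
   is spent on leaving the first block. *)
Definition conv (f g : nat -> nat) (n : nat) : nat :=
  \sum_(t < n) f t * g (n.-1 - t)%N.

Section Rates.
Variables (R : realType) (lam : R).
Hypothesis lam_gt0 : 0 < lam.
Implicit Types (f g : nat -> nat) (c : nat).

Lemma rate_le_leq c f g : (forall n, f n <= g n)%N ->
  rate_le lam c g -> rate_le lam c f.
Proof.
move=> fg; case: c => [[s [C [s0 H]]]|d [C H]]; [exists s, C; split=> // n|exists C => n];
  by apply: le_trans (H n); rewrite ler_nat.
Qed.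

Lemma rate_le0 c : rate_le lam c (fun=> 0%N).
Proof.
case: c => [|d]; last by exists 0 => n; rewrite mul0r.
by exists 0, 0; split=> [|n]; rewrite ?mul0r // lexx.
Qed.

Lemma rate_leD c f g : rate_le lam c f -> rate_le lam c g ->
  rate_le lam c (fun n => f n + g n)%N.
Proof.
case: c => [|d] /=.
- move=> [s [C [/andP[s0 sl] fC]]] [t [D [/andP[t0 tl] gD]]].
  exists (Num.max s t), (C + D); split=> [|n].
    by rewrite le_max s0 gt_max sl tl.
  (* Here and below, the bound at [n = 0] makes the constant non-negative. *)
  have C0 : 0 <= C by have := fC 0%N; rewrite expr0 mulr1; apply: le_trans.
  have D0 : 0 <= D by have := gD 0%N; rewrite expr0 mulr1; apply: le_trans.
  rewrite natrD mulrDl; apply: lerD; [apply: le_trans (fC n) _|apply: le_trans (gD n) _];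
    apply: ler_wpM2l => //; apply: lerXn2r; rewrite ?nnegrE ?le_max ?s0 ?t0 ?lexx ?orbT //.
- move=> [C fC] [D gD]; exists (C + D) => n.
  by rewrite natrD mulrDl; apply: lerD.
Qed.

Lemma rate_leM c f a : rate_le lam c f -> rate_le lam c (fun n => a * f n)%N.
Proof.
case: c => [[s [C [s0 H]]]|d [C H]]; [exists s, (a%:R * C); split=> // n|exists (a%:R * C) => n];
  by rewrite natrM -mulrA; apply: ler_wpM2l.
Qed.

Lemma rate_le_sum (I : finType) (Q : pred I) c (F : I -> nat -> nat) :
  (forall i, Q i -> rate_le lam c (F i)) ->
  rate_le lam c (fun n => \sum_(i | Q i) F i n)%N.
Proof.
move=> FH.
have : forall s : seq I, rate_le lam c (fun n => \sum_(i <- s | Q i) F i n)%N.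
  elim=> [|i s IH].
    by apply: rate_le_leq (rate_le0 c) => n; rewrite big_nil.
  case Qi: (Q i); last by apply: rate_le_leq IH => n; rewrite big_cons Qi.
  by apply: rate_le_leq (rate_leD (FH i Qi) IH) => n; rewrite big_cons Qi.
exact.
Qed.

Lemma rate_leW c c' f : (c <= c')%N -> rate_le lam c f -> rate_le lam c' f.
Proof.
move=> /subnK <-; elim: (c' - c)%N => // e IH /IH {IH}.
rewrite addSn; case: (e + c)%N => [[s [C [/andP[s0 sl] H]]]|d [C H]]; exists C => n.
- have C0 : 0 <= C by have := H 0%N; rewrite expr0 mulr1; apply: le_trans.
  apply: le_trans (H n) _; apply: ler_wpM2l => //; rewrite expr0 mul1r.
  by apply: lerXn2r; rewrite ?nnegrE // ltW.
- have C0 : 0 <= C.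
    by have := H 0%N; rewrite expr0 expr1n !mulr1; apply: le_trans.
  apply: le_trans (H n) _; apply: ler_wpM2l => //; apply: ler_wpM2r.
    by rewrite exprn_ge0 // ltW.
  by rewrite exprS ler_peMl ?exprn_ge0 // ler1n.
Qed.

(** The sum is [(s ^+ n - r ^+ n) / (s - r)]. *)
Lemma geometric_conv (r s : R) n : 0 <= r < s ->
  \sum_(t < n) r ^+ t * s ^+ (n.-1 - t) <= s ^+ n / (s - r).
Proof.
move=> /andP[r0 rs]; rewrite ler_pdivlMr ?subr_gt0 // mulrC.
under eq_bigr do rewrite mulrC.
by rewrite -subrXX gerBl exprn_ge0.
Qed.

(** Different ratios give a geometric sum, dominated by the larger ratio. Equal ratios give [n]
    terms of equal size, which raises the degree by one. *)
Lemma rate_le_conv c f g (r A : R) : 0 <= r <= lam ->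
  (forall n, (f n)%:R <= A * r ^+ n) -> rate_le lam c g ->
  rate_le lam ((r == lam) + c) (conv f g).
Proof.
move=> /andP[r0 rl] fA.
have A0 : 0 <= A by have := fA 0%N; rewrite expr0 mulr1; apply: le_trans.
have convE (G : nat -> R) n : (forall n, (g n)%:R <= G n) ->
    (conv f g n)%:R <= A * \sum_(t < n) r ^+ t * G (n.-1 - t)%N.
  move=> gG; rewrite natr_sum mulr_sumr; apply: ler_sum => t _.
  rewrite natrM mulrA; apply: ler_pM => //.
case: c => [|d].
- move=> [s [C [/andP[s0 sl] gC]]].
  have C0 : 0 <= C by have := gC 0%N; rewrite expr0 mulr1; apply: le_trans.
  have [rE|rnl] := eqVneq r lam.
    exists (A * (C / (lam - s))) => n; rewrite expr0 mul1r.
    apply: le_trans (convE _ n gC) _; rewrite -mulrA; apply: ler_wpM2l => //.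
    rewrite rE -mulrA [_^-1 * _]mulrC.
    apply: le_trans (_ : C * \sum_(t < n) s ^+ t * lam ^+ (n.-1 - t) <= _).
      (* Reversing the sum puts the smaller ratio [s] first, as [geometric_conv] requires. *)
      rewrite (reindex_inj rev_ord_inj) mulr_sumr; apply: ler_sum => t _ /=.
      rewrite mulrCA; apply: ler_wpM2l => //; rewrite [leRHS]mulrC.
      have -> : (n - t.+1 = n.-1 - t)%N by lia.
      by have -> : (n.-1 - (n.-1 - t) = t)%N by have := ltn_ord t; lia.
    by apply: ler_wpM2l => //; apply: geometric_conv; rewrite s0.
  have {rnl}rl : r < lam by rewrite lt_neqAle rnl.
  (* A ratio [q] strictly above [Num.max r s] still bounds [g] and keeps [q - r] positive, even when
     [r = s]. *)
  have [q [rq sq ql]] : exists q, [/\ r < q, s < q & q < lam].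
    pose u := Num.max r s; exists ((u + lam) / 2); have ru : r <= u by rewrite le_max lexx.
    have su : s <= u by rewrite le_max lexx orbT.
    have ul : u < lam by rewrite gt_max rl.
    by clearbody u; split; lra.
  exists q, (A * (C / (q - r))); split=> [|n]; first by rewrite ql andbT; lra.
  have gq m : (g m)%:R <= C * q ^+ m.
    apply: le_trans (gC m) _; apply: ler_wpM2l => //.
    by apply: lerXn2r; rewrite ?nnegrE //; lra.
  apply: le_trans (convE _ n gq) _; rewrite -mulrA; apply: ler_wpM2l => //.
  under eq_bigr do rewrite mulrCA.
  rewrite -mulr_sumr -mulrA [_^-1 * _]mulrC; apply: ler_wpM2l => //.
  by apply: geometric_conv; rewrite r0.
- move=> [C gC].
  have C0 : 0 <= C.
    by have := gC 0%N; rewrite expr0 expr1n !mulr1; apply: le_trans.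
  have convE' n : (conv f g n)%:R <= A * (C * (n.+1%:R ^+ d *
      \sum_(t < n) r ^+ t * lam ^+ (n.-1 - t)%N)).
    apply: le_trans (convE _ n gC) _; apply: ler_wpM2l => //.
    rewrite !mulr_sumr; apply: ler_sum => t _; rewrite mulrCA; apply: ler_wpM2l => //.
    rewrite mulrCA; apply: ler_wpM2r.
      by rewrite mulr_ge0 ?exprn_ge0 // ltW.
    by apply: lerXn2r; rewrite ?nnegrE // ler_nat; lia.
  have [rE|rnl] := eqVneq r lam; rewrite ?add0n ?add1n.
    (* Each of the [n] summands equals [lam ^+ n.-1], whence the division by [lam]. *)
    exists (A * (C / lam)) => n; apply: le_trans (convE' n) _.
    rewrite -!mulrA; apply: ler_wpM2l => //; apply: ler_wpM2l => //.
    rewrite ler_pdivlMl // mulrCA exprSr -mulrA.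
    apply: ler_wpM2l; first exact: exprn_ge0.
    rewrite mulr_sumr.
    apply: le_trans (_ : \sum_(t < n) lam ^+ n <= _).
      apply: ler_sum => t _; rewrite rE -exprD -exprS.
      by have -> : ((t + (n.-1 - t)).+1 = n)%N by have := ltn_ord t; lia.
    rewrite sumr_const card_ord -[_ *+ n]mulr_natl; apply: ler_wpM2r.
      by rewrite exprn_ge0 // ltW.
    by rewrite ler_nat.
  have {rnl}rl : r < lam by rewrite lt_neqAle rnl.
  exists (A * (C / (lam - r))) => n; apply: le_trans (convE' n) _.
  rewrite -!mulrA; apply: ler_wpM2l => //; apply: ler_wpM2l => //.
  rewrite mulrCA; apply: ler_wpM2l; first exact: exprn_ge0.
  by rewrite mulrC; apply: geometric_conv; rewrite r0.
Qed.

Lemma conv_ge f g n t : (t < n)%N -> (f t * g (n.-1 - t) <= conv f g n)%N.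
Proof. by move=> tn; rewrite /conv (bigD1 (Ordinal tn)) //= leq_addr. Qed.

Lemma convC f g n : conv f g n = conv g f n.
Proof.
rewrite /conv (reindex_inj rev_ord_inj); apply: eq_bigr => t _ /=.
have -> : (n - t.+1 = n.-1 - t)%N by lia.
rewrite mulnC; congr (g _ * _)%N.
by have := ltn_ord t; lia.
Qed.

Lemma rate_ge_leq c f g : (forall n, f n <= g n)%N ->
  rate_ge lam c f -> rate_ge lam c g.
Proof.
move=> fg; case: c => [[n Hn]|d [C [N [C0 H]]]].
  by exists n; apply: leq_trans (fg n).
by exists C, N; split=> // n /H Hn; apply: le_trans Hn _; rewrite ler_nat.
Qed.

(** Once [n >= 2 * a], [n - a] is at least [n / 2]; this costs [2^-1 ^+ d], and the exponential
    costs [lam ^- a]. *)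
Lemma rate_ge_shift c f : rate_ge lam c f -> (0 < c)%N ->
  forall a, rate_ge lam c (fun n => f (n - a)%N).
Proof.
case: c => // d [C [N [C0 H]]] _ a.
exists (C * (2^-1 ^+ d * lam ^- a)), (2 * a + N)%N; split.
  by rewrite !mulr_gt0 ?invr_gt0 ?exprn_gt0 // invr_gt0.
move=> n Hn; apply: le_trans (H _ _); last by lia.
rewrite -mulrA; apply: ler_wpM2l; first exact: ltW.
have lamE : lam ^- a * lam ^+ n = lam ^+ (n - a).
  have an : (n = a + (n - a))%N by lia.
  by rewrite {1}an exprD mulKf // gt_eqF // exprn_gt0.
rewrite mulrACA lamE; apply: ler_wpM2r.
  by rewrite exprn_ge0 // ltW.
rewrite -exprMn; apply: lerXn2r; rewrite ?nnegrE ?mulr_ge0 ?invr_ge0 //.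
have {1}-> : n = (n - a + a)%N by lia.
rewrite natrD; have : (a%:R : R) <= (n - a)%:R by rewrite ler_nat; lia.
by lra.
Qed.

(** One nonzero value [f a] already makes [conv f g] dominate a shift of [g]. *)
Lemma rate_ge_conv0 c f g : rate_ge lam 0 f -> rate_ge lam c g ->
  rate_ge lam c (conv f g).
Proof.
move=> [a fa] gc; have [c0|c0] := posnP c.
  move: gc; rewrite c0 => -[b gb]; exists (a + b).+1.
  have := @conv_ge f g (a + b).+1 a; rewrite /= addKn => H.
  by apply: leq_trans (H _); [rewrite muln_gt0 fa|lia].
case: c c0 gc => // d _ gc.
have [C [N [C0 H]]] := rate_ge_shift gc isT a.+1.
exists C, (maxn N a.+1); split=> // n; rewrite geq_max => /andP[Nn an].
apply: le_trans (H n Nn) _; rewrite ler_nat; apply: leq_trans (conv_ge _ _ an).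
have -> : (n.-1 - a = n - a.+1)%N by lia.
exact: leq_pmull.
Qed.

Lemma rate_ge_conv1 d f g : rate_ge lam 1 f -> rate_ge lam d.+1 g ->
  rate_ge lam d.+2 (conv f g).
Proof.
move=> [A [N1 [A0 fA]]] [B [N2 [B0 gB]]].
(* The terms with [N1 <= t < n/2] are at least [n/8] in number, and each has
   [n - 1 - t >= n/2]. *)
pose K : R := A * B * lam^-1 * 2^-1 ^+ d * 8^-1.
exists K, (8 * (N1 + N2 + 1))%N; split.
  by rewrite !mulr_gt0 ?invr_gt0 ?exprn_gt0 ?invr_gt0 // ?ltr0n.
move=> n Hn.
have term (t : nat) : (N1 <= t < n./2)%N ->
    A * B * lam^-1 * 2^-1 ^+ d * (n%:R ^+ d * lam ^+ n) <= (f t * g (n.-1 - t))%N%:R.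
  move=> /andP[t1 t2].
  have fAt := fA t t1.
  have gBt : B * ((n.-1 - t)%N%:R ^+ d * lam ^+ (n.-1 - t)) <= (g (n.-1 - t)%N)%:R.
    by apply: gB; lia.
  rewrite natrM; apply: le_trans (ler_pM _ _ fAt gBt); last 2 first.
  - by rewrite expr0 mul1r mulr_ge0 ?exprn_ge0 // ltW.
  - by rewrite !mulr_ge0 ?exprn_ge0 // ltW.
  rewrite expr0 mul1r.
  have -> : A * lam ^+ t * (B * ((n.-1 - t)%N%:R ^+ d * lam ^+ (n.-1 - t))) =
    A * B * ((n.-1 - t)%N%:R ^+ d * (lam ^+ t * lam ^+ (n.-1 - t))) by ring.
  rewrite -exprD.
  have -> : A * B * lam^-1 * 2^-1 ^+ d * (n%:R ^+ d * lam ^+ n) =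
     A * B * ((2^-1 ^+ d * n%:R ^+ d) * (lam^-1 * lam ^+ n)) by ring.
  (* One factor [lam] is lost because the exponents add up to [n - 1]. *)
  have -> : lam^-1 * lam ^+ n = lam ^+ (t + (n.-1 - t)).
    have {1}-> : n = (t + (n.-1 - t)).+1 by lia.
    by rewrite exprS mulKf // gt_eqF.
  apply: ler_wpM2l; first by rewrite mulr_ge0 // ltW.
  apply: ler_wpM2r; first by rewrite exprn_ge0 // ltW.
  rewrite -exprMn; apply: lerXn2r; rewrite ?nnegrE ?mulr_ge0 ?invr_ge0 //.
  rewrite ler_pdivrMl ?ltr0n // -natrM ler_nat; lia.
set T := A * B * _ * _ * (_ * _) in term.
have T0 : 0 <= T by rewrite /T !mulr_ge0 ?exprn_ge0 ?invr_ge0 // ltW.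
apply: (@le_trans _ _ ((n./2 - N1)%N%:R * T)).
  have -> : K * (n%:R ^+ d.+1 * lam ^+ n) = 8^-1 * n%:R * T.
    by rewrite /K /T exprS; ring.
  apply: ler_wpM2r => //; rewrite ler_pdivrMl ?ltr0n // -natrM ler_nat; lia.
rewrite /conv -(big_mkord xpredT (fun t => f t * g (n.-1 - t))%N).
rewrite (@big_cat_nat _ _ _ N1) //=; last by lia.
rewrite (@big_cat_nat _ _ _ n./2 N1 n) //=; [|lia|lia].
apply: (@le_trans _ _ (\sum_(N1 <= t < n./2) f t * g (n.-1 - t))%N%:R); last first.
  by rewrite ler_nat; lia.
rewrite natr_sum -mulr_natl [(n./2 - N1)%N%:R * 1]mulr1 mulr_natl -sumr_const_nat.
by apply: ler_sum_nat => t; apply: term.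
Qed.

Lemma rate_ge_conv (b : bool) c f g : rate_ge lam b f -> rate_ge lam c g ->
  rate_ge lam (b + c) (conv f g).
Proof.
case: b => [fb gc|]; last exact: rate_ge_conv0.
case: c gc => [|d] gc; last exact: rate_ge_conv1.
(* Here [f] has class [1] and [g] has class [0], so the two exchange roles. *)
by apply: rate_ge_leq (rate_ge_conv0 gc fb) => n; rewrite convC.
Qed.

End Rates.

(** With [q = p * p], one factor [p ^+ n] absorbs [n.+1%:R] and the other absorbs the remaining
    power by induction. *)
Lemma poly_le_exp (R : realType) (d : nat) (q : R) : 1 < q ->
  exists C, forall n, n.+1%:R ^+ d <= C * q ^+ n.
Proof.
elim: d q => [|d IH] q q1.
  by exists 1 => n; rewrite expr0 mul1r exprn_ege1 // ltW.
pose p := Num.sqrt q.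
have p1 : 1 < p by rewrite -sqrtr1 ltr_sqrt //; lra.
have pE : p * p = q by rewrite -expr2 sqr_sqrtr //; lra.
(* Since [K * (p - 1) >= 1], the quantity [K * p ^+ n] grows by at least one at each step. *)
pose K := 1 + (p - 1)^-1.
have K1 : 1 <= K by rewrite lerDl invr_ge0; lra.
have Kp : 1 <= K * (p - 1) by rewrite mulrDl mulVf ?subr_eq0 ?gt_eqF //; lra.
have Kn n : n.+1%:R <= K * p ^+ n.
  elim: n => [|n IHn]; first by rewrite expr0 mulr1.
  have pn : 1 <= p ^+ n by rewrite exprn_ege1 // ltW.
  rewrite -natr1 exprSr.
  have : 1 * 1 <= K * (p - 1) * p ^+ n by apply: ler_pM.
  by lra.
have [C HC] := IH p p1; exists (K * C) => n.
rewrite exprS -pE exprMn mulrACA; apply: ler_pM => //; exact: exprn_ge0.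
Qed.

(** * Comparison of growth classes *)

Section Uniqueness.
Variables (R : realType).
Implicit Types (f : nat -> nat) (lam mu : R).

(** A ratio halfway between [mu] and [lam] absorbs the polynomial factor. *)
Lemma rate_le_lt lam mu c f : 0 < mu -> mu < lam -> rate_le mu c f -> rate_le lam 0 f.
Proof.
move=> mu0 ml; case: c => [[s [C [/andP[s0 sm] H]]]|d [C H]].
  by exists s, C; split=> //; rewrite s0 (lt_trans sm).
pose s := (mu + lam) / 2; have [ms sl] : mu < s /\ s < lam by rewrite /s; lra.
have [|K HK] := @poly_le_exp R d (s / mu); first by rewrite ltr_pdivlMr // mul1r.
have C0 : 0 <= C.
  by have := H 0%N; rewrite expr0 expr1n !mulr1; apply: le_trans.
exists s, (C * K); split=> [|n]; first by rewrite sl andbT; lra.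
apply: le_trans (H n) _; rewrite -mulrA; apply: ler_wpM2l => //.
apply: le_trans (ler_wpM2r _ (HK n)) _; first by rewrite exprn_ge0 // ltW.
by rewrite -mulrA expr_div_n divfK // gt_eqF // exprn_gt0.
Qed.

Lemma rate_le0_ge lam d f : rate_le lam 0 f -> ~ rate_ge lam d.+1 f.
Proof.
move=> [s [C [/andP[s0 sl] H]]] [c [N [c0 G]]].
have l0 : 0 < lam by apply: le_lt_trans sl.
(* The extra powers with exponent [N.+1] move the index obtained beyond [N] and keep it positive, so
   that its [d]-th power is at least [1]. *)
have [||n] := @exp_dominates R lam s (c * lam ^+ N.+1) (C * s ^+ N.+1).
- by rewrite s0.
- by rewrite mulr_gt0 // exprn_gt0.
rewrite -!mulrA -!exprD; apply/negP; rewrite -leNgt.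
apply: le_trans (H _); apply: le_trans (G _ _); last by lia.
apply: ler_wpM2l; first exact: ltW.
by rewrite ler_peMl ?exprn_ge0 ?exprn_ege1 ?ler1n ?addSn // ltW.
Qed.

(** Used in both directions, it shows that [f] determines [lam] and [d]; with [mu = 1] and [c = 0]
    it separates the two alternatives of the theorem. *)
Lemma rates_unique lam mu d c f : 1 <= mu ->
  rate_ge lam d.+1 f -> rate_le mu c f -> lam <= mu /\ (lam = mu -> (d < c)%N).
Proof.
move=> mu1 G H; split.
  rewrite leNgt; apply/negP => ml; apply: rate_le0_ge G.
  by apply: rate_le_lt ml H; lra.
move=> lmE; subst lam; case: c H => [|d'] H; first by case: (rate_le0_ge H G).
rewrite ltnS leqNgt; apply/negP => dd'.
case: G H => [c [N [c0 G]]] [C H].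
have C0 : 0 <= C.
  by have := H 0%N; rewrite expr0 expr1n !mulr1; apply: le_trans.
(* As [n.+1 <= 2 * n] and [d' < d], the two bounds give [c * n <= C * 2 ^+ d'], that is [n <= K]; a
   larger [n] refutes this. *)
pose K := C * 2 ^+ d' / c.
pose n := (maxn N (Num.trunc K)).+1.
have : K < n%:R.
  apply: lt_le_trans (truncnS_gt _) _.
  by rewrite ler_nat /n ltnS leq_maxr.
apply/negP; rewrite -leNgt ler_pdivlMr // mulrC.
have n1 : 1 <= n%:R :> R by rewrite ler1n.
rewrite -(@ler_pM2r _ (n%:R ^+ d' * mu ^+ n)); last first.
  by rewrite mulr_gt0 ?exprn_gt0 //; lra.
apply: (@le_trans _ _ (c * (n%:R ^+ d * mu ^+ n))).
  rewrite -mulrA; apply: ler_wpM2l; first exact: ltW.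
  rewrite mulrA -exprS; apply: ler_wpM2r; first by rewrite exprn_ge0; lra.
  by rewrite ler_weXn2l.
apply: le_trans (G n _) _; first by rewrite /n; lia.
apply: le_trans (H n) _; rewrite -mulrA; apply: ler_wpM2l => //.
rewrite mulrA -exprMn; apply: ler_wpM2r; first by rewrite exprn_ge0; lra.
apply: lerXn2r; rewrite ?nnegrE ?mulr_ge0 // -natrM ler_nat; lia.
Qed.

Lemma rate_le1_0 f : rate_le (1 : R) 0 f -> \forall n \near \oo, f n = 0%N.
Proof.
move=> [s [C [s0 H]]].
have q1 : `|s| < 1 by case/andP: s0 => s0 s1; rewrite ger0_norm.
have : (fun n => C * s ^+ n) @ \oo --> C * 0.
  by apply: cvgMr; apply: cvg_expr.
rewrite mulr0 => /cvgr_lt /(_ _ (@ltr01 R)) [N _ HN].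
exists N => // n /HN /= Hn; apply/eqP; rewrite -leqn0 -ltnS -(ltr_nat R).
exact: le_lt_trans (H n) Hn.
Qed.

(** [rate_le] bounds every [n], with [n.+1] avoiding a zero bound at [n = 0]. The passage costs
    finitely many initial values one way and a factor [2 ^+ d] the other way. *)
Lemma bigTheta_rates lam d f : 1 <= lam ->
  ((fun n => (f n)%:R : R^o) =Theta_\oo
    (fun n => n%:R ^+ d * lam ^+ n : R^o)) <->
  rate_le lam d.+1 f /\ rate_ge lam d.+1 f.
Proof.
move=> l1; have l0 : 0 <= lam by lra.
have normE n : `|n%:R ^+ d * lam ^+ n : R^o| = n%:R ^+ d * lam ^+ n.
  by rewrite ger0_norm // mulr_ge0 // exprn_ge0.
have normf n : `|(f n)%:R : R^o| = (f n)%:R by rewrite normr_nat.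
rewrite eqThetaE qualifE; split=> [/asboolP[[k1 k2] /= /andP[k10 k20] [N _ HN]]|].
  split; last first.
    by exists k1, N; split=> // n /HN [+ _]; rewrite normE normf.
  pose S : R := (\sum_(m < N) f m)%N%:R.
  exists (S + k2) => n.
  have g1 : 1 <= n.+1%:R ^+ d * lam ^+ n :> R.
    rewrite -[X in X <= _]mulr1; apply: ler_pM => //.
      by rewrite exprn_ege1 // ler1n.
    by rewrite exprn_ege1.
  have S0 : 0 <= S by [].
  have [Nn|nN] := leqP N n.
    have [_] := HN n Nn; rewrite normE normf => /le_trans; apply.
    apply: ler_pM; rewrite ?mulr_ge0 ?exprn_ge0 //; [exact: ltW|lra|].
    apply: ler_wpM2r; first by rewrite exprn_ge0.
    by apply: lerXn2r; rewrite ?nnegrE // ler_nat.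
  apply: le_trans (_ : S <= _).
    by rewrite ler_nat (bigD1 (Ordinal nN)) //= leq_addr.
  have : 0 <= (S + k2) * (n.+1%:R ^+ d * lam ^+ n - 1) by rewrite mulr_ge0; lra.
  by lra.
move=> [[C H] [c [N [c0 G]]]]; apply/asboolP.
have C0 : 0 <= C.
  by have := H 0%N; rewrite expr0 expr1n !mulr1; apply: le_trans.
exists (c, (C + 1) * 2 ^+ d) => /=.
  by rewrite c0 mulr_gt0 ?exprn_gt0 //; lra.
exists N.+1 => // n /= Nn; rewrite normE normf; split; first by apply: G; lia.
apply: le_trans (H n) _; rewrite -mulrA; apply: ler_pM => //.
- by rewrite mulr_ge0 ?exprn_ge0.
- by lra.
rewrite mulrA -exprMn; apply: ler_wpM2r; first by rewrite exprn_ge0.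
by apply: lerXn2r; rewrite ?nnegrE ?mulr_ge0 // -natrM ler_nat; lia.
Qed.

End Uniqueness.

Lemma horner_mx_coef (F : fieldType) n (A : 'M[F]_n.+1) (q : {poly F}) :
  horner_mx A q = \sum_(i < size q) q`_i *: A ^+ i.
Proof.
rewrite -{1}[q]coefK poly_def rmorph_sum /=; apply: eq_bigr => i _.
by rewrite linearZ /= rmorphXn /= horner_mx_X.
Qed.

Lemma leq_bigsum (I : finType) (Q : pred I) (F : I -> nat) i :
  Q i -> (F i <= (\sum_(j | Q j) F j)%R)%N.
Proof. by move=> Qi; rewrite (bigD1 i) //= leq_addr. Qed.

(** * Block decomposition of the powers *)

Section Blocks.
Variables (h : nat) (p : 'I_h -> nat).
Variable M : 'M[nat]_(\sum_(l < h) p l).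
Hypothesis M_upper : forall k l : 'I_h, (l < k)%N -> submxblock M k l = 0.

Local Notation B := (submxblock M).
Local Notation MX n := (submxblock (M ^+ n)).

Lemma submxblockM (S : pzSemiRingType) (A A' : 'M[S]_(\sum_(l < h) p l)) k l :
  submxblock (A *m A') k l = \sum_m submxblock A k m *m submxblock A' m l.
Proof.
rewrite -{1}[A]submxblockK -{1}[A']submxblockK.
by rewrite mul_mxblock mxblockK.
Qed.

Lemma submxblock1 (k l : 'I_h) : k != l -> MX 0 k l = 0.
Proof.
move=> kl; apply/matrixP => a b; rewrite expr0 !mxE.
case: eqP => // /(congr1 tagnat.sig1); rewrite !tagnat.Rank1K => /eqP.
by rewrite (negPf kl).
Qed.

Lemma submxblock1_diag (k : 'I_h) : MX 0 k k = 1%:M.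
Proof.
apply/matrixP => a b; rewrite expr0 !mxE; congr ((_ : bool)%:R).
by rewrite -val_eqE /= tagnat.eq_Rank eqxx.
Qed.

Lemma submxblockS n (k l : 'I_h) :
  MX n.+1 k l = B k k *m MX n k l + \sum_(m | m != k) B k m *m MX n m l.
Proof. by rewrite exprS -mulmxE submxblockM (bigD1 k). Qed.

(** Paths are sorted by the number [t] of steps made inside block [k] before the exit to some [m].
    The term with [MX 0 k l], which is the identity or zero, accounts for paths that never leave. *)
Lemma submxblock_unfold n (k l : 'I_h) :
  MX n k l = B k k ^+ n *m MX 0 k l +
   \sum_(t < n) \sum_(m | m != k) B k k ^+ t *m (B k m *m MX (n.-1 - t)%N m l).
Proof.
elim: n => [|n IH]; first by rewrite big_ord0 addr0 expr0 mul1mx.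
rewrite submxblockS {1}IH mulmxDr mulmxA -addrA; congr (_ + _).
  by rewrite [B k k ^+ n.+1]exprS.
rewrite addrC big_ord_recl subn0; congr (_ + _).
  by apply: eq_bigr => m _; rewrite expr0 mul1mx.
rewrite mulmx_sumr; apply: eq_bigr => t _.
rewrite mulmx_sumr; apply: eq_bigr => m _.
have -> : (n.+1.-1 - lift ord0 t = n.-1 - t)%N.
  by rewrite lift0 /=; have := ltn_ord t; lia.
by rewrite mulmxA [B k k ^+ (lift ord0 t)]exprS.
Qed.

(** Exits are grouped by the entry [B k m x y] they use, so that each group is a convolution. *)
Lemma submxblock_entry n (k l : 'I_h) a b :
  MX n k l a b = (B k k ^+ n *m MX 0 k l) a b +
   \sum_(m | m != k) \sum_x \sum_y B k m x y *
     conv (fun t => (B k k ^+ t) a x) (fun t => MX t m l y b) n.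
Proof.
rewrite submxblock_unfold [LHS]mxE; congr (_ + _).
rewrite summxE.
under eq_bigr => t _.
  rewrite summxE.
  under eq_bigr => m _.
    rewrite mxE.
    under eq_bigr => x _.
      rewrite [X in _ * X]mxE mulr_sumr.
      under eq_bigr do rewrite mulrCA.
      over.
    over.
  over.
rewrite exchange_big /=; apply: eq_bigr => m _.
rewrite exchange_big /=; apply: eq_bigr => x _.
rewrite exchange_big /=; apply: eq_bigr => y _.
by rewrite -mulr_sumr.
Qed.

Lemma block_chains_cons (k m l : 'I_h) s : (k < m)%N -> B k m != 0 ->
  block_chains M m l s -> block_chains M k l (k :: s).
Proof.
move=> km Bkm [s' [-> ls ps]]; exists (m :: s'); split=> //=.
by rewrite km Bkm.
Qed.

(** Used contrapositively: blocks not joined by a chain vanish in all powers. A nonzero summand of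
    [submxblockS] yields the first edge, which is increasing by triangularity. *)
Lemma block_chains_nonzero n (k l : 'I_h) :
  MX n k l != 0 -> exists s, block_chains M k l s.
Proof.
elim: n k => [|n IH] k.
  have [->|kl] := eqVneq k l; last by rewrite submxblock1 // eqxx.
  by exists [:: l], [::].
rewrite submxblockS; have [->|/IH //] := eqVneq (MX n k l) 0.
rewrite mulmx0 add0r => S0.
have [m /andP[mk /negP Bm]] : exists m, (m != k) && (B k m *m MX n m l != 0).
  apply/existsP; rewrite -[[exists _, _]]negbK negb_exists.
  apply: contra S0 => /forallP H; apply/eqP/big1 => m mk.
  by have := H m; rewrite mk negbK => /eqP.
have Bkm0 : B k m != 0 by apply/eqP => B0; apply: Bm; rewrite B0 mul0mx.
have Xm0 : MX n m l != 0 by apply/eqP => X0; apply: Bm; rewrite X0 mulmx0.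
have km : (k < m)%N.
  rewrite ltnNge leq_eqVlt negb_or val_eqE mk /=; apply/negP => /M_upper B0.
  by rewrite B0 eqxx in Bkm0.
by have [s ms] := IH m Xm0; exists (k :: s); apply: block_chains_cons ms.
Qed.

Lemma block_chains_sorted k l s : block_chains M k l s ->
  sorted (fun m m' : 'I_h => (m < m')%N) s.
Proof.
move=> [s' [-> _]] /=; apply: sub_path => x y /andP[]//.
Qed.

Lemma block_chains_le k l s : block_chains M k l s -> (k <= l)%N.
Proof.
move=> ks; have := block_chains_sorted ks; case: ks => s' [-> <- _] /=.
rewrite path_sortedE => [/andP[/allP H _]|x y z]; last exact: ltn_trans.
have := mem_last k s'; rewrite inE => /predU1P[->//|/H /ltnW//].
Qed.

(** Bounds the chain counts, so that they have a maximum. *)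
Lemma block_chains_size k l s : block_chains M k l s -> (size s <= h)%N.
Proof.
move=> /block_chains_sorted ss.
have us : uniq s.
  apply: sorted_uniq ss => [x y z|x]; [exact: ltn_trans|exact: ltnn].
by rewrite -(card_uniqP us) -[h in (_ <= h)%N]card_ord max_card.
Qed.

(** Indices increase along a chain, so no path returns to block [k] after leaving it. *)
Lemma submxblockX n k : MX n k k = B k k ^+ n.
Proof.
rewrite submxblock_unfold submxblock1_diag mulmx1 big1 ?addr0 // => t _.
apply: big1 => m mk; rewrite -[RHS](mulmx0 _ (B k k ^+ t)); congr (_ *m _).
case: (ltnP m k) => [/M_upper ->|km]; first by rewrite mul0mx.
have [->|/block_chains_nonzero[s /block_chains_le mk']] := eqVneq (MX (n.-1 - t)%N m k) 0.
  by rewrite mulmx0.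
by case/eqP: mk; apply/val_inj/eqP; rewrite eqn_leq mk'.
Qed.

(** * Growth of the entries of a block *)

Section Growth.
Variable R : realType.
Hypothesis p_gt0 : forall l : 'I_h, (0 < p l)%N.
Hypothesis M_diag : forall l : 'I_h, primitive_mx (B l l) \/ (p l = 1%N /\ B l l = 0).
Local Notation rho := (block_radius R M).

Lemma block_radius_ge0 k : 0 <= rho k.
Proof. exact: (spectral_radius_ge0 _ _ (p_gt0 k)). Qed.

Lemma diag_upper k a b : exists A, forall n, ((B k k ^+ n) a b)%:R <= A * rho k ^+ n.
Proof.
have [prim|[pk Bk]] := M_diag k; first exact: primitive_upper.
(* For the zero block [rho k = 0], and the convention [0 ^+ 0 = 1] covers [n = 0]. *)
exists 1 => n; rewrite mul1r /block_radius Bk spectral_radius0 // !expr0n.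
by case: n => [|n] /=; rewrite mxE //; case: eqP => _; rewrite ?lexx ?ler01.
Qed.

(** Class [0] asks for a single nonzero value: primitivity supplies one, and for the zero block the
    power [0] does. *)
Lemma diag_lower (lam : R) k a b : 1 <= lam ->
  rate_ge lam (rho k == lam) (fun n => (B k k ^+ n) a b).
Proof.
move=> l1; have [prim|[pk Bk]] := M_diag k.
  have [<-|_] := eqVneq; last by have [n _ Hn] := prim; exists n.
  have [c [N [c0 H]]] := primitive_lower R (p_gt0 k) prim a b.
  by exists c, N; split=> // n /H; rewrite expr0 mul1r.
rewrite /block_radius Bk spectral_radius0 // lt_eqF; last by lra.
exists 0%N; rewrite expr0 mxE.
suff -> : a = b by rewrite eqxx.
have ord1 (i : 'I_(p k)) : (i < 1)%N.
  by apply: leq_trans (ltn_ord i) _; rewrite pk.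
by apply: val_inj => /=; have := ord1 a; have := ord1 b; lia.
Qed.

(** Induction from the last block backwards. If [rho k = lam], leaving [k] for [m] lowers the count
    allowed to chains from [m] by one, and [rate_le_conv] adds this unit back. *)
Lemma block_upper (lam : R) c k l : 1 <= lam ->
  (forall s, block_chains M k l s ->
    (forall m, m \in s -> rho m <= lam) /\ (chain_count M lam s <= c)%N) ->
  forall a b, rate_le lam c (fun n => MX n k l a b).
Proof.
move=> l1; have l0 : 0 < lam by lra.
have [w] := ubnP (h - k)%N; elim: w => // w IH in k c *.
rewrite ltnS => kw chainP a b.
apply: (rate_le_leq (fun n => eq_leq (submxblock_entry n a b))).
apply: rate_leD.
  have [kl|kl] := eqVneq k l; last first.
    apply: (rate_le_leq _ (rate_le0 l0 c)) => n.
    by rewrite submxblock1 // mulmx0 mxE.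
  subst l; have [|/(_ k)] := chainP [:: k]; first by exists [::].
  rewrite inE eqxx => /(_ isT) rk; rewrite /chain_count /= addn0 => ck.
  apply: rate_leW ck _ => //.
  have [A HA] := diag_upper a b.
  have HA' n : ((B k k ^+ n *m MX 0 k k) a b)%:R <= A * rho k ^+ n.
    by rewrite submxblock1_diag mulmx1.
  have [rE|rl] := eqVneq (rho k) lam.
    by exists A => n; rewrite expr0 mul1r -rE.
  exists (rho k), A; split=> //; rewrite lt_neqAle rl rk andbT.
  by rewrite block_radius_ge0.
apply: (rate_le_sum l0) => m mk.
apply: (rate_le_sum l0) => x _.
apply: (rate_le_sum l0) => y _.
have [B0|Bkm] := eqVneq (B k m) 0.
  by apply: (rate_le_leq _ (rate_le0 l0 c)) => n; rewrite B0 mxE mul0r.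
apply: rate_leM.
have km : (k < m)%N.
  rewrite ltnNge leq_eqVlt negb_or val_eqE mk /=; apply/negP => /M_upper B0.
  by rewrite B0 eqxx in Bkm.
(* A chain from [m], extended by [k], yields [rho k <= lam] and shows that the subtraction from [c]
   is not truncated. Without such a chain the convolution vanishes. *)
have [[s ms]|nos] := pselect (exists s, block_chains M m l s); last first.
  apply: (rate_le_leq _ (rate_le0 l0 c)) => n.
  rewrite leqn0 /conv big1 // => t _.
  have [->|/block_chains_nonzero//] := eqVneq (MX (n.-1 - t)%N m l) 0.
  by rewrite mxE muln0.
have chainP' s' : block_chains M m l s' ->
    (forall j, j \in s' -> rho j <= lam) /\
    [/\ rho k <= lam, ((rho k == lam) <= c)%N & (chain_count M lam s' <= c - (rho k == lam))%N].
  move=> /(block_chains_cons km Bkm)/chainP[Hr Hc]; split.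
    by move=> j js; apply: Hr; rewrite inE js orbT.
  split; first by apply: Hr; rewrite inE eqxx.
    by move: Hc; rewrite /chain_count /=; lia.
  by move: Hc; rewrite /chain_count /=; lia.
have [_ [rk ck _]] := chainP' s ms.
rewrite -(subnKC ck); have [A HA] := diag_upper a x.
apply: (rate_le_conv l0 _ HA); first by rewrite rk andbT block_radius_ge0.
apply: IH; first by have := ltn_ord k; lia.
by move=> s' /chainP'[? [_ _ ?]].
Qed.

(** Induction along the chain, keeping at each block one exit through a positive entry and
    discarding all other terms. *)
Lemma block_lower (lam : R) k l s : 1 <= lam -> block_chains M k l s ->
  forall a b, rate_ge lam (chain_count M lam s) (fun n => MX n k l a b).
Proof.
move=> l1 [s' [-> + +]]; have l0 : 0 < lam by lra.
elim: s' k => [|m s' IH] k /=.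
  move=> -> _ a b; rewrite /chain_count /= addn0.
  apply: (rate_ge_leq _ (diag_lower a b l1)) => n.
  by rewrite submxblockX.
move=> ls /andP[/andP[km Bkm] ps] a b.
have [x [y Bxy]] : exists x y, (0 < B k m x y)%N.
  apply: contra_notP (negP Bkm) => H; apply/eqP/matrixP => x y; rewrite [RHS]mxE.
  by apply/eqP; rewrite -leqn0 leqNgt; apply/negP => Bxy; apply: H; exists x, y.
have := rate_ge_conv l0 (diag_lower a x l1) (IH m ls ps y b).
apply: rate_ge_leq => n; rewrite submxblock_entry.
have mk : m != k by rewrite -val_eqE gtn_eqF.
apply: leq_trans (leq_addl _ _).
apply: leq_trans (@leq_bigsum _ _ (fun m => \sum_x \sum_y B k m x y * _)%R m mk).
apply: leq_trans (@leq_bigsum _ _ (fun x => \sum_y B k m x y * _)%R x isT).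
apply: leq_trans (@leq_bigsum _ _ (fun y => B k m x y * _)%R y isT).
exact: leq_pmull.
Qed.

End Growth.

End Blocks.

(* Evaluate the characteristic polynomial of [A] at [Q] and apply an eigenvector. *)
Lemma eigenvalue_of_powers (F : fieldType) N n (A : 'M[F]_N) (Q : 'M[F]_n)
    (f : 'I_n -> 'I_N) (z : F) :
  (forall t a b, (A ^+ t) (f a) (f b) = (Q ^+ t) a b) ->
  eigenvalue Q z -> eigenvalue A z.
Proof.
move=> AQ /eigenvalueP[v vQ v0].
have [b vb0] : exists b, v 0 b != 0.
  apply/existsP; rewrite -[[exists _, _]]negbK negb_exists.
  apply: contra v0 => /forallP H; apply/eqP/rowP => b; rewrite mxE.
  by apply/eqP; have := H b; rewrite negbK.
case: N => [|N] in A f AQ *; first by case: (f b).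
rewrite eigenvalue_root_char /root; set q := char_poly A.
rewrite -(mulIr_eq0 _ (mulIf vb0)).
have vQt t : \sum_a v 0 a * (Q ^+ t) a b = z ^+ t * v 0 b.
  by have /rowP/(_ b) := eigenvector_mulX t vQ; rewrite !mxE.
have CH a : \sum_(i < size q) q`_i * (Q ^+ i) a b = 0.
  have /matrixP/(_ (f a))/(_ (f b)) := Cayley_Hamilton A.
  rewrite horner_mx_coef summxE [X in _ = X]mxE => CHab; rewrite -[RHS]CHab.
  by apply: eq_bigr => i _; rewrite mxE AQ.
apply/eqP; rewrite horner_coef mulr_suml.
under eq_bigr do rewrite -mulrA -vQt mulr_sumr.
rewrite exchange_big big1 //= => a _.
under eq_bigr do rewrite mulrCA.
by rewrite -mulr_sumr CH mulr0.
Qed.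

(** * Spectrum of the block matrix and choice of the rate *)

Section Main.
Variables (R : realType) (h : nat) (p : 'I_h -> nat).
Variable M : 'M[nat]_(\sum_(l < h) p l).
Hypothesis p_gt0 : forall l : 'I_h, (0 < p l)%N.
Hypothesis M_upper : forall k l : 'I_h, (l < k)%N -> submxblock M k l = 0.
Hypothesis M_diag : forall l : 'I_h, primitive_mx (submxblock M l l) \/
                (p l = 1%N /\ submxblock M l l = 0).
Local Notation rho := (block_radius R M).

Lemma spec_block k z : z \in spec R (submxblock M k k) -> z \in spec R M.
Proof.
rewrite !mem_spec; apply: (eigenvalue_of_powers (f := tagnat.Rank k)) => t a b.
by rewrite !natr_mxX -(submxblockX M_upper) mxE.
Qed.

(** A block of radius at least [1] is not the zero block, so it is primitive and has its Perron root
    as an eigenvalue. *)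
Lemma block_radius_spec k : 1 <= rho k -> (rho k)%:C \in spec R M.
Proof.
move=> rk; apply: (@spec_block k); have [prim|[_ Bk]] := M_diag k.
  exact: perron_root.
by move: rk; rewrite /block_radius Bk spectral_radius0 // ler10.
Qed.

Lemma chain_radius_ge s m : m \in s -> rho m <= chain_radius R M s.
Proof. by move=> ms; rewrite /chain_radius; apply: le_bigmax_seq. Qed.

Lemma chain_radius_le (lam : R) s : 0 <= lam -> (forall m, m \in s -> rho m <= lam) ->
  chain_radius R M s <= lam.
Proof.
by move=> l0 sl; rewrite /chain_radius big_seq; apply: bigmax_le => // m /sl.
Qed.

(** The alternative, [lam] and [d] are fixed before [a] and [b]; this is why all entries of a block
    behave alike. The case split is whether some block on a chain has radius at least [1]. *)
Lemma block_dichotomy k l :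
  (forall a b, rate_le (1 : R) 0 (fun n => submxblock (M ^+ n) k l a b)) \/
  exists lam d, [/\ lam%:C \in spec R M, 1 <= lam,
    is_max [set chain_radius R M s | s in block_chains M k l] lam,
    is_max [set chain_count M lam s | s in block_chains M k l] d.+1 &
    forall a b, rate_le lam d.+1 (fun n => submxblock (M ^+ n) k l a b) /\
                rate_ge lam d.+1 (fun n => submxblock (M ^+ n) k l a b)].
Proof.
pose P m := `[< exists2 s, block_chains M k l s & m \in s >].
have [[m0 Pm0 rm0]|small] := pselect (exists2 m, P m & 1 <= rho m); last first.
  (* All radii are below [1], so no block of a chain counts for [lam = 1]. *)
  left; apply: block_upper => // s ks.
  have s1 m : m \in s -> rho m < 1.
    move=> ms; rewrite ltNge; apply/negP => rm; apply: small; exists m => //.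
    by apply/asboolP; exists s.
  split=> [m /s1/ltW//|]; rewrite leqn0 /chain_count -leqn0 leqNgt -has_count.
  by apply/hasPn => m /s1 rm; rewrite lt_eqF.
right; pose m1 := [arg max_(m > m0 | P m) rho m]%O; pose lam := rho m1.
have [Pm1 lam_max] : P m1 /\ forall m, P m -> rho m <= lam.
  by rewrite /lam /m1; case: arg_maxP.
have l1 : 1 <= lam by apply: le_trans rm0 (lam_max _ Pm0).
have /asboolP[s1 ks1 m1s1] := Pm1.
have chain_le s m : block_chains M k l s -> m \in s -> rho m <= lam.
  by move=> ks ms; apply: lam_max; apply/asboolP; exists s.
pose Q c := `[< exists2 s, block_chains M k l s & chain_count M lam s = c >].
have Qh c : Q c -> (c <= h)%N.
  move=> /asboolP[s /block_chains_size sh <-].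
  by apply: leq_trans sh; apply: count_size.
have Q1 : exists c, Q c by exists (chain_count M lam s1); apply/asboolP; exists s1.
have [c Qc cmax] := ex_maxnP Q1 Qh.
(* The chain through [m1] counts at least one block, so [c] is a successor. *)
have c0 : (0 < c)%N.
  apply: leq_trans (cmax (chain_count M lam s1) _); last by apply/asboolP; exists s1.
  by rewrite -has_count; apply/hasP; exists m1.
have cE : c = c.-1.+1 by rewrite prednK.
exists lam, c.-1; rewrite -cE; split=> //; first exact: block_radius_spec.
- split; last first.
    move=> _ [s ks <-]; apply: chain_radius_le; first by lra.
    by move=> m; apply: chain_le.
  exists s1 => //; apply/eqP; rewrite eq_le chain_radius_ge // andbT.
  apply: chain_radius_le; first by lra.
  by move=> m; apply: chain_le.
- split; first by have /asboolP[s ks sc] := Qc; exists s.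
  by move=> _ [s ks <-]; apply: cmax; apply/asboolP; exists s.
move=> a b; split.
  apply: block_upper => // s ks; split=> [m|]; first exact: chain_le.
  by apply: cmax; apply/asboolP; exists s.
by have /asboolP[s ks <-] := Qc; apply: block_lower.
Qed.

End Main.

(* [tagnat.Rank k a] is the index, in the whole matrix, of row (or column) [a]
   of the [k]-th block. *)
Theorem lemma11 (R : realType) (h : nat) (p : 'I_h -> nat)
    (M : 'M[nat]_(\sum_(l < h) p l))
    (p_gt0 : forall l : 'I_h, (0 < p l)%N)
    (M_upper : forall k l : 'I_h, (l < k)%N -> submxblock M k l = 0)
    (M_diag : forall l : 'I_h, primitive_mx (submxblock M l l) \/
                (p l = 1%N /\ submxblock M l l = 0)) :
  [/\ forall i j : 'I_(\sum_(l < h) p l),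
        eventually_zero M i j \/
        exists (lam : R) (d : nat), has_growth M i j lam d,
      forall (k l : 'I_h) (a : 'I_(p k)) (b : 'I_(p l)) (lam : R) (d : nat),
        (k <= l)%N ->
        has_growth M (tagnat.Rank k a) (tagnat.Rank l b) lam d ->
        is_max [set chain_radius R M s | s in block_chains M k l] lam /\
        is_max [set chain_count M lam s | s in block_chains M k l] d.+1
    & forall (k l : 'I_h) (a a' : 'I_(p k)) (b b' : 'I_(p l)),
        (k <= l)%N ->
        (eventually_zero M (tagnat.Rank k a) (tagnat.Rank l b) <->
         eventually_zero M (tagnat.Rank k a') (tagnat.Rank l b')) /\
        (forall (lam : R) (d : nat),
          has_growth M (tagnat.Rank k a) (tagnat.Rank l b) lam d <->
          has_growth M (tagnat.Rank k a') (tagnat.Rank l b') lam d)].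
Proof.
have entry k l a b : (fun n => submxblock (M ^+ n) k l a b) =
    (fun n => (M ^+ n) (tagnat.Rank k a) (tagnat.Rank l b)).
  by apply/funext => n; rewrite mxE.
have small_zero k l a b : rate_le (1 : R) 0 (fun n => submxblock (M ^+ n) k l a b) ->
    eventually_zero M (tagnat.Rank k a) (tagnat.Rank l b).
  by rewrite entry; apply: rate_le1_0.
have zero_small k l a b : eventually_zero M (tagnat.Rank k a) (tagnat.Rank l b) ->
    forall (lam : R) d, 1 <= lam ->
    ~ rate_ge lam d.+1 (fun n => submxblock (M ^+ n) k l a b).
  move=> [N _ HN] lam d l1 [c [N' [c0 G]]].
  (* The index lies beyond both thresholds and is positive, so its [d]-th power cannot vanish. *)
  have := G (maxn N N').+1; rewrite mxE (HN _ _); last by rewrite /=; lia.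
  move=> /(_ _); rewrite leNgt => /(_ ltac:(lia)) /negP; apply.
  by rewrite !mulr_gt0 ?exprn_gt0 ?ltr0n //; lra.
have growth_rates k l a b (lam : R) d :
    has_growth M (tagnat.Rank k a) (tagnat.Rank l b) lam d ->
    [/\ lam%:C \in spec R M, 1 <= lam,
     rate_le lam d.+1 (fun n => submxblock (M ^+ n) k l a b) &
     rate_ge lam d.+1 (fun n => submxblock (M ^+ n) k l a b)].
  by move=> [? l1 /(bigTheta_rates _ _ l1)]; rewrite entry => -[].
have rates_growth k l a b (lam : R) d : lam%:C \in spec R M -> 1 <= lam ->
     rate_le lam d.+1 (fun n => submxblock (M ^+ n) k l a b) /\
     rate_ge lam d.+1 (fun n => submxblock (M ^+ n) k l a b) ->
    has_growth M (tagnat.Rank k a) (tagnat.Rank l b) lam d.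
  by rewrite entry => ? l1 /(bigTheta_rates _ _ l1).
have unique (f : nat -> nat) (lam mu : R) d e : 1 <= lam -> 1 <= mu ->
    rate_le lam d.+1 f -> rate_ge lam d.+1 f ->
    rate_le mu e.+1 f /\ rate_ge mu e.+1 f -> lam = mu /\ d = e.
  move=> l1 m1 lu ll [mu_u mu_l].
  have [lm de] := rates_unique m1 ll mu_u.
  have [ml ed] := rates_unique l1 mu_l lu.
  have lmE : lam = mu by apply/le_anti; rewrite lm ml.
  by split=> //; have := de lmE; have := ed (esym lmE); lia.
have small_ge (f : nat -> nat) (lam : R) d :
    rate_le (1 : R) 0 f -> 1 <= lam -> ~ rate_ge lam d.+1 f.
  move=> s0 l1 ll; have [l1' lt0] := rates_unique (lexx 1) ll s0.
  by have := lt0 (le_anti (introT andP (conj l1' l1))).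
have dich := @block_dichotomy R h p M p_gt0 M_upper M_diag.
split.
(* Every index is the [tagnat.Rank] of its block and its position there. *)
- move=> i j; rewrite -(tagnat.sig2K i) -(tagnat.sig2K j).
  set k := tagnat.sig1 i; set l := tagnat.sig1 j.
  have [small|[lam [d [lspec l1 _ _ rates]]]] := dich k l.
    by left; apply: small_zero.
  by right; exists lam, d; apply: rates_growth.
- move=> k l a b lam d _ /growth_rates[lspec l1 lu ll].
  have [small|[mu [e [_ m1 maxr maxc rates]]]] := dich k l.
    by case: (small_ge _ _ _ (small a b) l1 ll).
  by have [-> ->] := unique _ _ _ _ _ l1 m1 lu ll (rates a b).
move=> k l a a' b b' _.
have [small|[mu [e [mspec m1 _ _ rates]]]] := dich k l.
  split=> [|lam d]; first by split=> _; apply: small_zero.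
  by split=> /growth_rates[_ l1 _ ll];
    [case: (small_ge _ _ _ (small a b) l1 ll)|
     case: (small_ge _ _ _ (small a' b') l1 ll)].
split=> [|lam d].
  by split=> z; [have [_ ll] := rates a b|have [_ ll] := rates a' b'];
    case: (zero_small _ _ _ _ z _ _ m1 ll).
by split=> /growth_rates[_ l1 lu ll];
  [have [-> ->] := unique _ _ _ _ _ l1 m1 lu ll (rates a b)|
   have [-> ->] := unique _ _ _ _ _ l1 m1 lu ll (rates a' b')];
  apply: rates_growth.
Qed.
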